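(* Let $\gamma\in[0,1]$ and let $T\ge 0$ be a fixed integer that does not depend on $C$. Consider a slotted network of capacity $C$ requests per slot ($C$ a positive integer), with i.i.d. Poisson arrivals of rate $\lambda=C^{\gamma}$ per slot, in which every request has the same lookahead time $T$ (a request arriving at the beginning of slot $n$ may be served in any of the slots $n,n+1,\dots,n+T$), operated under the earliest-deadline-first policy. Let $P_P(\text{outage})$ be its steady-state outage probability. Then the diversity gain of this proactive ($T$-slot predictive) network is $$d_P(\gamma)=\lim_{C\to\infty}\frac{-\log P_P(\text{outage})}{C\log C}=(1+T)(1-\gamma).$$ In particular, for the non-predictive network, which is the special case $T=0$, the diversity gain is $d_N(\gamma)=1-\gamma$, so that $d_P(\gamma)=(1+T)\,d_N(\gamma)$.
   Context: Model. Time is slotted, $n=1,2,\dots$. At the beginning of slot $n$, $Q(n)$ requests arrive; the $Q(n)$ are i.i.d. Poisson random variables with mean $\lambda$. Each request needs exactly one unit of resource and is served entirely within one slot. The network has a fixed capacity of $C$ units per slot, i.e. it can serve at most $C$ requests in each slot. The system starts empty. Deadlines. A request arriving at the beginning of slot $n$ with lookahead time $T$ has deadline slot $n+T$: it can be served in any of the slots $n,\dots,n+T$. If it has not been served by the end of slot $n+T$, it expires in slot $n+T$ and leaves the system. In the non-predictive network, $T=0$: every request must be served in its arrival slot. Scheduling. Service follows the earliest-deadline-first (EDF) policy: in every slot the network serves as many of the requests present in the system as the capacity allows (all of them if there are at most $C$, otherwise $C$ of them), giving priority to requests with the earliest deadlines. With a common $T$ this is the same as first-in-first-out. Outage. An outage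 occurs in slot $n$ if and only if at least one request expires in slot $n$. $P(\text{outage})$ is the steady-state probability of outage, i.e. the limit as $n\to\infty$ of the probability that an outage occurs in slot $n$. Scaling and diversity gain. The arrival rate scales with capacity as $\lambda=C^{\gamma}$ with $\gamma\in[0,1]$ fixed, and the diversity gain is $d(\gamma)=\lim_{C\to\infty}\frac{-\log P(\text{outage})}{C\log C}$. The subscripts $P$ and $N$ denote the predictive and non-predictive networks, respectively. *)

(* Defs.v *)
From HB Require Import structures.
From mathcomp Require Import all_boot all_order all_algebra finmap.
From mathcomp Require Import all_classical all_reals all_analysis.
Set Implicit Arguments.
Unset Strict Implicit.
Unset Printing Implicit Defensive.
Import Order.TTheory GRing.Theory Num.Theory.
Import numFieldNormedType.Exports.
Local Open Scope classical_set_scope.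
Local Open Scope ring_scope.

(** Slots are numbered 1, 2, ...; [q n] requests arrive at the beginning of
    slot [n] (the value [q 0] plays no role).  A pending request is represented
    by its deadline slot, and the content of the system by the sequence of the
    deadlines of its pending requests, with repetitions. *)

(** Requests left unserved at the end of slot [n], when [w] was waiting at the
    end of slot [n - 1] and [a] requests arrive: earliest-deadline-first serves
    the first [C] requests in the order of increasing deadlines. *)
Definition unserved (C T n a : nat) (w : seq nat) : seq nat :=
  drop C (sort leq (w ++ nseq a (n + T)%N)).

(** Requests carried over from slot [n] to the next one: those that expire in
    slot [n] leave, and the system starts empty. *)
Fixpoint waiting (C T : nat) (q : nat -> nat) (n : nat) : seq nat :=
  if n is m.+1
  then [seq k <- unserved C T n (q n) (waiting C T q m) | k != n]
  else [::].

Definition outage (C T : nat) (q : nat -> nat) (n : nat) : bool :=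
  n \in unserved C T n (q n) (waiting C T q n.-1).

Section Probability.
Context {d : measure_display} {Omega : measurableType d} {R : realType}.
Variable P : probability Omega R.

Definition mutually_independent (X : nat -> {RV P >-> nat}) : Prop :=
  forall (J : {fset nat}) (B : nat -> set nat),
    (forall j, measurable (B j)) ->
    P (\bigcap_(j in [set` J]) (X j @^-1` B j)) =
    (\prod_(j <- J) P (X j @^-1` B j))%E.

Definition iid_poisson (lambda : R) (X : nat -> {RV P >-> nat}) : Prop :=
  (forall j k, distribution P (X j) [set k] = (poisson_pmf lambda k)%:E) /\
  mutually_independent X.

Definition outage_prob (C T : nat) (Q : nat -> {RV P >-> nat}) (n : nat)
    : \bar R :=
  P [set w | outage C T (fun k => Q k w) n].

Definition steady_outage_prob (C T : nat) (Q : nat -> {RV P >-> nat})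
    : \bar R :=
  limn (outage_prob C T Q).

End Probability.

Section DiversityGain.
Context {d : nat -> measure_display} {Omega : forall C, measurableType (d C)}
  {R : realType}.
Variable P : forall C, probability (Omega C) R.
Variable Q : forall C, nat -> {RV (P C) >-> nat}.

(** The logarithm is the extended one, so that [- lne 0 = +oo]. *)
Definition diversity_ratio (T C : nat) : \bar R :=
  (- lne (steady_outage_prob C T (Q C)) / (C%:R * ln C%:R)%:E)%E.

Definition diversity_gain (T : nat) : \bar R := limn (diversity_ratio T).

End DiversityGain.

(* Main.v *)
(** The system that ignores the first slot always holds a final segment of the
    queue of the full system, so by stationarity of the arrivals the outage
    probability is nondecreasing in the slot and has a limit.  That limit is at
    least the probability that slot 1 alone brings more than [(T + 1) C]
    requests, which already gives the exponent [(1 + T)(1 - gamma)].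
    Conversely, tracing an outage back to the start of its busy period shows
    that, for some [j >= 1], [j] consecutive slots ending [T] slots earlier
    brought more than [(T + j) C] requests.  The Chernoff bound with parameter
    [z = C^(1 - gamma)] bounds this by [z^-(T C) x^j] with [x = (e / z)^C], a
    geometric series in [j] dominated by its first term, of the same exponent.
    For [gamma = 1] the trivial bound 1 on the probability suffices. *)

Require Import Defs.
From HB Require Import structures.
From mathcomp Require Import all_boot all_order all_algebra finmap.
From mathcomp Require Import all_classical all_reals all_analysis.
From mathcomp Require Import zify ring lra.
Set Implicit Arguments.
Unset Strict Implicit.
Unset Printing Implicit Defensive.
Import Order.TTheory GRing.Theory Num.Theory.
Import numFieldNormedType.Exports.
Local Open Scope classical_set_scope.
Local Open Scope ring_scope.

(** * Counting and suffixes in sequences *)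

Lemma count_drop_ge (U : Type) (p : pred U) (k : nat) (s : seq U) :
  (count p s - k <= count p (drop k s))%N.
Proof.
rewrite -{1}(cat_take_drop k s) count_cat leq_subLR leq_add2r.
by rewrite (leq_trans (count_size _ _))// size_take; case: ltnP.
Qed.

Lemma sorted_all_ge (x : nat) (s : seq nat) :
  sorted leq (x :: s) -> all (leq x) s.
Proof. by rewrite (sorted_pairwise leq_trans) /= => /andP[]. Qed.

(** In a sorted sequence the entries at most [h] form a prefix, so they are the first to be dropped:
    service goes to them before any later deadline. *)
Lemma count_le_drop (h k : nat) (s : seq nat) : sorted leq s ->
  count (fun x => x <= h)%N (drop k s) = (count (fun x => x <= h)%N s - k)%N.
Proof.
elim: s k => [|x s IH] [|k] //= xs; rewrite ?subn0//.
rewrite IH ?(path_sorted xs)//; case: leqP => [_|hx]; first by rewrite add1n.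
suff -> : count (fun y => y <= h)%N s = 0%N by [].
apply/eqP; rewrite -leqn0 leqNgt -has_count; apply/hasPn => y ys.
by rewrite -ltnNge (leq_trans hx)// (allP (@sorted_all_ge _ _ xs)).
Qed.

Lemma suffix_filter (U : eqType) (p : pred U) (s s' : seq U) :
  suffix s s' -> suffix [seq x <- s | p x] [seq x <- s' | p x].
Proof.
by move=> /suffixP[u ->]; rewrite filter_cat; apply/suffixP; eexists.
Qed.

Lemma drop_suffix (U : eqType) (k : nat) (s s' : seq U) :
  suffix s s' -> suffix (drop k s) (drop k s').
Proof.
move=> /suffixP[u ->]; rewrite drop_cat; case: ltnP => [_|uk].
  exact/suffix_catr/suffix_drop.
by rewrite -{1}(subnK uk) addnC -drop_drop suffix_drop.
Qed.

(** * Queue dynamics under earliest-deadline-first *)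

Section Dynamics.
Variables C T : nat.
Implicit Types (q : nat -> nat) (n m a k : nat) (w : seq nat).

(** Invariant of the queue at the end of slot [n]: arrivals of the next slot have deadline
    [n.+1 + T], so appending them keeps the queue sorted and EDF becomes first-in-first-out. *)
Definition admissible n w := sorted leq w && all (fun k => k <= n + T)%N w.

Lemma admissible_cat n a w : admissible n w ->
  admissible n.+1 (w ++ nseq a (n.+1 + T)%N).
Proof.
move=> /andP[sw /allP lw]; apply/andP; split; last first.
  rewrite all_cat all_nseq leqnn orbT andbT; apply/allP => k /lw; lia.
rewrite sorted_pairwise; last exact: leq_trans.
rewrite pairwise_cat -!(sorted_pairwise leq_trans) sw/=; apply/andP; split.
  by apply/allrelP => x y /lw xn /nseqP[-> _]; lia.
elim: a => //= -[//|a] IH /=; rewrite leqnn; exact: IH.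
Qed.

Lemma unservedE n a w : admissible n w ->
  unserved C T n.+1 a w = drop C (w ++ nseq a (n.+1 + T)%N).
Proof.
move=> /(@admissible_cat n a)/andP[s _]; rewrite /unserved sorted_sort//.
exact: leq_trans.
Qed.

Lemma admissible_unserved n a w : admissible n w ->
  admissible n.+1 (unserved C T n.+1 a w).
Proof.
move=> aw; rewrite unservedE//; have /andP[s l] := @admissible_cat n a _ aw.
rewrite /admissible drop_sorted//=; apply/allP => k /mem_drop.
exact: (allP l).
Qed.

Lemma admissible_waiting q n : admissible n (waiting C T q n).
Proof.
elim: n => // n /(@admissible_unserved n (q n.+1))/andP[s l].
rewrite /admissible (sorted_filter leq_trans)//=.
by rewrite all_filter; apply: sub_all l => k lek; apply/implyP.
Qed.

Lemma eq_waiting q q' n :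
  (forall k, (0 < k <= n)%N -> q k = q' k) ->
  waiting C T q n = waiting C T q' n.
Proof.
elim: n => //= n IH qq'; rewrite IH ?qq' ?leqnn// => k /andP[k0 kn].
by rewrite qq'// k0 leqW.
Qed.

Lemma eq_outage q q' n :
  (forall k, (0 < k <= n.+1)%N -> q k = q' k) ->
  outage C T q n.+1 = outage C T q' n.+1.
Proof.
move=> qq'; rewrite /outage (eq_waiting (q' := q')) ?qq'//=.
by move=> k /andP[k0 kn]; rewrite qq'// k0 leqW.
Qed.

(* Dropping the requests of slot 1 shifts time by one slot; the system that
   starts later always holds a final segment of the other one's queue. *)
Lemma suffix_unserved n a w w' :
  admissible n w' -> admissible n.+1 w -> suffix (map succn w') w ->
  suffix (map succn (unserved C T n.+1 a w')) (unserved C T n.+2 a w).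
Proof.
move=> aw' aw /suffixP[u def_w].
rewrite !unservedE// map_drop map_cat map_nseq def_w -catA.
exact/drop_suffix/suffix_suffix.
Qed.

Lemma suffix_waiting q n :
  suffix (map succn (waiting C T (fun k => q k.+1) n)) (waiting C T q n.+1).
Proof.
elim: n => [|n IH]; first exact: suffix0s.
rewrite [waiting C T q n.+2]/= [waiting _ _ _ n.+1 in X in suffix X _]/=.
have -> : forall s, [seq i.+1 | i <- s & i != n.+1] =
    [seq i <- map succn s | i != n.+2] by move=> s; rewrite filter_map.
apply/suffix_filter/suffix_unserved => //; exact: admissible_waiting.
Qed.

Lemma outage_delayed_start q n :
  outage C T (fun k => q k.+1) n.+1 -> outage C T q n.+2.
Proof.
have /suffixP[u] := @suffix_unserved n (q n.+2) _ _
  (admissible_waiting (fun k => q k.+1) n) (admissible_waiting q n.+1)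
  (suffix_waiting q n).
rewrite /outage => -> o; rewrite mem_cat; apply/orP; right.
by rewrite mem_map//; exact: succn_inj.
Qed.

(** While requests with deadline at most [h] are left over, all [C] services of each slot go to such
    requests. Going back to the last slot [m] at whose end none was waiting, arrivals with deadline
    at most [h] must account for all these services and for the remainder. *)
Lemma count_unserved_backlog q n h :
  (0 < count (fun k => k <= h)%N
        (unserved C T n.+1 (q n.+1) (waiting C T q n)))%N ->
  exists2 m, (m <= n)%N &
    (count (fun k => k <= h)%N
      (unserved C T n.+1 (q n.+1) (waiting C T q n)) + (n.+1 - m) * C
     <= \sum_(m.+1 <= i < n.+2 | i + T <= h) q i)%N.
Proof.
elim: n => [|n IH].
  rewrite unservedE // count_le_drop; last first.
    by have /andP[] := @admissible_cat 0 (q 1%N) [::] isT.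
  rewrite /= count_nseq => c0; exists 0%N => //.
  rewrite big_ltn_cond// big_geq// addn0.
  rewrite subn0 mul1n; move: c0.
  by case: (leqP (1 + T) h) => _ /=; rewrite ?mul1n ?mul0n => c0; lia.
have an := admissible_waiting q n.+1.
rewrite unservedE // count_le_drop; last first.
  by have /andP[] := @admissible_cat _ (q n.+2) _ an.
rewrite count_cat count_nseq => c0.
set c := count _ (waiting _ _ _ _) in c0 *.
(* Either the busy period starts in this slot, or it extends further back and the induction
   hypothesis supplies [m]. *)
have [cz|cp] := posnP c.
  exists n.+1 => //; rewrite big_ltn_cond// big_geq// addn0.
  rewrite subSnn mul1n; move: c0; rewrite cz.
  by case: (leqP (n.+2 + T) h) => _ /=; rewrite ?mul1n ?mul0n => *; lia.
have cle : (c <= count (fun k => k <= h)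
    (unserved C T n.+1 (q n.+1) (waiting C T q n)))%N.
  rewrite /c /= count_filter; apply: sub_count => k /=; by case/andP.
have [m mn le_m] := IH (leq_trans cp cle).
exists m; first lia.
rewrite big_mkcond big_nat_recr/=; last lia.
rewrite -big_mkcond/=.
have -> : (n.+2 - m = (n.+1 - m).+1)%N by lia.
rewrite mulSn; move: c0 le_m cle.
by case: (leqP (n.+2 + T) h) => _ /=; rewrite ?mul1n ?mul0n => *; lia.
Qed.

(* If [m] is the last slot before the outage at whose end no request with a
   deadline up to the outage was waiting, the requests arrived in the [j] slots
   [m + 1, ..., n + 1 - T] overload the [T + j] slots [m + 1, ..., n + 1]. *)
Lemma outage_busy_period q n : outage C T q n.+1 ->
  exists j, [/\ (0 < j)%N, (T + j <= n.+1)%N &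
    ((T + j) * C < \sum_((n.+1 - T - j).+1 <= i < (n.+1 - T).+1) q i)%N].
Proof.
rewrite /outage /= => o.
have [|m mn] := @count_unserved_backlog q n n.+1.
  by rewrite -has_count; apply/hasP; exists n.+1.
have : (0 < count (fun k => k <= n.+1)%N
        (unserved C T n.+1 (q n.+1) (waiting C T q n)))%N.
  by rewrite -has_count; apply/hasP; exists n.+1.
move: (count _ _) => c c0 le_c.
(* Arrivals after slot [n.+1 - T] have deadlines beyond [n.+1]; were [m] that late, the sum would be
   empty although [c] is positive. *)
have [jle|jgt] := leqP (n.+1 - T)%N m.
  move: le_c; rewrite big_nat_cond big1; first by rewrite leqNgt addn_gt0 c0.
  by move=> i /andP[/andP[? ?] ?]; lia.
exists (n.+1 - T - m)%N; split; [lia|lia|].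
have -> : (n.+1 - T - (n.+1 - T - m) = m)%N by lia.
have -> : (T + (n.+1 - T - m) = n.+1 - m)%N by lia.
move: le_c; rewrite (@big_cat_nat _ _ _ (n.+1 - T).+1)/=; [|lia|lia].
rewrite [X in (_ <= _ + X)%N](_ : _ = 0%N); last first.
  by rewrite big_nat_cond big1// => i /andP[/andP[? ?] ?]; lia.
rewrite addn0 big_nat_cond [in X in _ -> X]big_nat_cond.
rewrite (eq_bigl (fun i => (m < i < (n.+1 - T).+1)%N && true)); first by lia.
by move=> i; rewrite andbT; apply: andb_idr => /andP[? ?]; lia.
Qed.

(** The requests of slot 1 all have deadline [T.+1]; none expires earlier, and each of the slots 1
    to [T.+1] serves at most [C] of them. *)
Lemma outage_first_burst q : (T.+1 * C < q 1%N)%N -> outage C T q T.+1.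
Proof.
move=> q1.
have count_unserved n a w : (count_mem T.+1 w - C <=
    count_mem T.+1 (unserved C T n a w))%N.
  rewrite /unserved (leq_trans _ (count_drop_ge _ _ _))//.
  by rewrite count_sort count_cat; lia.
have count_first : (q 1%N - C <=
    count_mem T.+1 (unserved C T 1 (q 1%N) [::]))%N.
  rewrite /unserved (leq_trans _ (count_drop_ge _ _ _))//.
  by rewrite count_sort count_cat count_nseq/= add1n eqxx mul1n.
have count_n n : (n <= T)%N -> (q 1%N - n.+1 * C <=
    count_mem T.+1 (unserved C T n.+1 (q n.+1) (waiting C T q n)))%N.
  elim: n => [_|n IH nT]; first by rewrite mul1n.
  rewrite (leq_trans _ (count_unserved _ _ _))//=.
  rewrite count_filter (@eq_count _ _ (pred1 T.+1)); last first.
    by move=> k /=; case: eqP => //= ->; rewrite eqSS gtn_eqF.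
  by move: (IH (ltnW nT)); rewrite !mulSn; lia.
have := count_n T (leqnn T); rewrite /outage /= -has_pred1 has_count.
by apply: leq_trans; rewrite subn_gt0.
Qed.

End Dynamics.

(** * Expectations as iterated series, and the Chernoff bound *)

Section IteratedSeries.
Context {R : realType}.
Local Open Scope ereal_scope.
Implicit Types (p : nat -> R) (F G : seq nat -> \bar R) (n : nat).

(* The expectation of [F] over [n] independent variables with probability mass
   function [p], written as an iterated series. *)
Fixpoint iterated_series p n F : \bar R :=
  if n is m.+1
  then \sum_(0 <= k <oo) (p k)%:E * iterated_series p m (fun t => F (k :: t))
  else F [::].

Lemma iterated_series_ge0 p n F : (forall k, (0 <= p k)%R) ->
  (forall t, 0 <= F t) -> 0 <= iterated_series p n F.
Proof.
move=> p0; elim: n F => [|n IH] F F0 //=.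
by apply: nneseries_ge0 => k _ _; rewrite mule_ge0 ?lee_fin// IH.
Qed.

Lemma le_iterated_series p n F G : (forall k, (0 <= p k)%R) ->
  (forall t, 0 <= F t) -> (forall t, F t <= G t) ->
  iterated_series p n F <= iterated_series p n G.
Proof.
move=> p0; elim: n F G => [|n IH] F G F0 FG //=.
apply: lee_nneseries => k _.
  by rewrite mule_ge0 ?lee_fin// iterated_series_ge0.
by rewrite lee_wpmul2l ?lee_fin// IH.
Qed.

(** The generating function of a sum of independent variables is a product. The factor [c] lets the
    induction absorb the power of [z] coming from the first variable. *)
Lemma iterated_series_expn p (z c M : R) n :
  (forall k, (0 <= p k)%R) -> (0 <= z)%R -> (0 <= c)%R ->
  \sum_(0 <= k <oo) (p k * z ^+ k)%:E = M%:E ->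
  iterated_series p n (fun t => (c * z ^+ sumn t)%:E) = (c * M ^+ n)%:E.
Proof.
move=> p0 z0 + sumM; elim: n c => [|n IH] c c0 /=; first by rewrite !expr0.
under eq_eseriesr => k _.
  rewrite (_ : (fun t => _) = (fun t => (c * z ^+ k * z ^+ sumn t)%:E)).
    rewrite IH ?mulr_ge0 ?exprn_ge0// -EFinM.
    rewrite (_ : p k * _ = (c * M ^+ n) * (p k * z ^+ k))%R; last by ring.
    rewrite EFinM; over.
  by apply/funext => t; rewrite exprD mulrA.
rewrite nneseriesZl ?sumM -?EFinM ?exprSr ?mulrA// => k _.
by rewrite lee_fin mulr_ge0 ?exprn_ge0.
Qed.

(** For [z] at least 1, the indicator of [m <= sumn t] is at most [z ^- m * z ^+ sumn t]. *)
Lemma chernoff_iterated_series p (z M : R) n m :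
  (forall k, (0 <= p k)%R) -> (1 <= z)%R ->
  \sum_(0 <= k <oo) (p k * z ^+ k)%:E = M%:E ->
  iterated_series p n (fun t => (m <= sumn t)%N%:R%:E)
    <= (z ^- m * M ^+ n)%:E.
Proof.
move=> p0 z1 sumM; have z0 : (0 < z)%R by exact: lt_le_trans z1.
rewrite -(iterated_series_expn n p0 (ltW z0) _ sumM); last first.
  by rewrite invr_ge0 exprn_ge0// ltW.
apply: le_iterated_series => // t; rewrite lee_fin ?ler0n//.
case: leqP => mt; last by rewrite mulr_ge0 ?invr_ge0 ?exprn_ge0// ltW.
by rewrite mulrC ler_pdivlMr ?exprn_gt0// mul1r ler_weXn2l.
Qed.

(* Tilting by [z ^+ k] turns Poisson(lambda) into a multiple of
   Poisson(lambda z), whose total mass is 1. *)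
Lemma poisson_mgf (lambda z : R) : (0 < lambda)%R -> (0 < z)%R ->
  \sum_(0 <= k <oo) (poisson_pmf lambda k * z ^+ k)%:E =
  (expR (lambda * (z - 1)))%:E.
Proof.
move=> l0 z0.
have lz0 : (0 < lambda * z)%R by rewrite mulr_gt0.
have tilt k : (poisson_pmf lambda k * z ^+ k =
    expR (lambda * (z - 1)) * poisson_pmf (lambda * z) k)%R.
  rewrite /poisson_pmf l0 lz0 exprMn.
  rewrite (_ : - lambda = lambda * (z - 1) + - (lambda * z))%R; last by ring.
  by rewrite expRD; ring.
under eq_eseriesr => k _ do rewrite tilt EFinM.
rewrite nneseriesZl; last by move=> k _; rewrite lee_fin poisson_pmf_ge0.
rewrite nneseries_esumT; last by move=> k; rewrite lee_fin poisson_pmf_ge0.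
have := @probability_setT _ _ R (poisson_prob (lambda * z) 0).
by rewrite /= /poisson_prob lz0 => ->; rewrite mule1.
Qed.

End IteratedSeries.

(** * Law of the arrivals in a window of slots *)

Section Arrivals.
Context {d : measure_display} {Omega : measurableType d} {R : realType}.
Variables (P : probability Omega R) (p : nat -> R).
Variable X : nat -> {RV P >-> nat}.
Hypothesis pmf_X : forall j k, distribution P (X j) [set k] = (p k)%:E.
Hypothesis indep_X : mutually_independent X.
Implicit Types (s n : nat) (t : seq nat) (E : pred (seq nat)).

Definition arrivals s n w := [seq X i w | i <- iota s n].

Lemma pmf_ge0 k : 0 <= p k.
Proof. by rewrite -lee_fin -(pmf_X 0) measure_ge0. Qed.

Lemma measurable_arrivals s n E : measurable [set w | E (arrivals s n w)].
Proof.
elim: n s E => [|n IH] s E.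
  rewrite /arrivals /=; case: (E _).
    by rewrite (_ : mkset _ = setT)//; apply/seteqP; split.
  by rewrite (_ : mkset _ = set0)//; apply/seteqP; split.
rewrite (_ : mkset _ = \bigcup_k ((X s @^-1` [set k]) `&`
    [set w | E (k :: arrivals s.+1 n w)])); last first.
  apply/seteqP; split => [w Ew|w [k _ [/= <-]]//].
  by exists (X s w).
apply: bigcup_measurable => k _.
apply: measurableI; first exact: measurable_funPTI.
exact: (IH s.+1 (fun t => E (k :: t))).
Qed.

(** Independence enters here, on cylinders: it is applied to the slots of the window and to
    singletons. *)
Lemma prob_arrivals_eq s t :
  P [set w | arrivals s (size t) w = t] = (\prod_(k <- t) p k)%:E.
Proof.
pose J := [fset i in iota s (size t)]%fset.
have := @indep_X J (fun j => [set nth 0%N t (j - s)]) (fun=> I).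
have -> : (\prod_(j <- J) P (X j @^-1` [set nth 0%N t (j - s)]) =
    \prod_(j <- iota s (size t)) P (X j @^-1` [set nth 0%N t (j - s)]))%E.
  apply/perm_big/uniq_perm; [exact: fset_uniq|exact: iota_uniq|move=> i].
  by rewrite in_fset.
have -> : (\prod_(j <- iota s (size t)) P (X j @^-1` [set nth 0%N t (j - s)]) =
    (\prod_(k <- t) p k)%:E)%E.
  rewrite -[X in iota X](addn0 s) iotaDl big_map.
  rewrite (eq_bigr (fun j => (p (nth 0%N t j))%:E)); last first.
    by move=> j _; rewrite addKn -(pmf_X (s + j)).
  by rewrite prodEFin -[in RHS](mkseq_nth 0%N t) big_map.
move=> <-.
congr (P _); apply/seteqP; split => w /=.
  move=> wt j; rewrite /= in_fset mem_iota => /andP[sj js] /=.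
  rewrite -[in RHS]wt (nth_map 0%N) ?size_iota ?nth_iota ?subnKC//; lia.
move=> wJ; apply: (@eq_from_nth _ 0%N).
  by rewrite size_map size_iota.
move=> i; rewrite size_map size_iota => it.
rewrite (nth_map 0%N) ?size_iota// nth_iota//.
have := wJ (s + i)%N; rewrite /= in_fset mem_iota addKn; apply; lia.
Qed.

(** Induction on [n]: the event splits disjointly over the value [k] of the next slot, which joins
    the fixed prefix [t]. Thus only the probabilities of fully specified windows are needed. *)
Lemma prob_arrivals_cond s t n E :
  P ([set w | arrivals s (size t) w = t] `&`
     [set w | E (arrivals (s + size t) n w)]) =
  ((\prod_(k <- t) p k)%:E *
    iterated_series p n (fun u => (E u)%:R%:E))%E.
Proof.
elim: n t E => [|n IH] t E.
  rewrite {2}/arrivals /=; case: (E [::]).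
    rewrite mule1 -(prob_arrivals_eq s); congr (P _).
    by apply/seteqP; split => [w []|w].
  rewrite mule0 -(measure0 P); congr (P _).
  by apply/seteqP; split => [w []|w].
have arrivals_rcons w k :
    (arrivals s (size (rcons t k)) w = rcons t k) <->
    (arrivals s (size t) w = t /\ X (s + size t) w = k).
  rewrite /arrivals size_rcons -addn1 iotaD map_cat /= cats1.
  by split=> [/rcons_inj[-> ->]//|[-> ->]].
pose A k := [set w | arrivals s (size (rcons t k)) w = rcons t k] `&`
  [set w | E (k :: arrivals (s + size (rcons t k)) n w)].
rewrite (_ : _ `&` _ = \bigcup_k A k); last first.
  apply/seteqP; split => w.
    move=> [/= wt Ew]; exists (X (s + size t) w) => //; split.
      exact/arrivals_rcons.
    by rewrite /= size_rcons addnS.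
  move=> [k _ [/arrivals_rcons[wt wk] /= Ek]]; split => //=.
  by move: Ek; rewrite size_rcons addnS /arrivals /= wk.
rewrite measure_bigcup; last 2 first.
- move=> k _; apply: measurableI.
    have := @measurable_arrivals s (size (rcons t k)) (pred1 (rcons t k)).
    by congr measurable; apply/seteqP; split => w /eqP.
  exact: (@measurable_arrivals _ _ (fun u => E (k :: u))).
- apply/trivIsetP => i j _ _ /eqP ij; apply/seteqP; split => // w.
  move=> [[/arrivals_rcons[_ wi] _] [/arrivals_rcons[_ wj] _]].
  by apply: ij; rewrite -wi -wj.
rewrite -nneseriesZl; last first.
  move=> k _; rewrite mule_ge0 ?lee_fin ?pmf_ge0//.
  by apply: iterated_series_ge0 => [i|u]; rewrite ?pmf_ge0// lee_fin ler0n.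
rewrite (eq_eseriesl (Q := predT)); last by move=> k; rewrite in_setT.
apply: eq_eseriesr => k _.
apply: (etrans (IH (rcons t k) (fun u => E (k :: u)))).
by rewrite big_rcons/= EFinM muleA.
Qed.

(** The right-hand side does not mention [s]: this is the stationarity of the arrivals. *)
Lemma prob_arrivals s n E : P [set w | E (arrivals s n w)] =
  iterated_series p n (fun u => (E u)%:R%:E).
Proof.
have := prob_arrivals_cond s [::] n E.
rewrite big_nil mul1e /= addn0 => <-; congr (P _).
by apply/seteqP; split => [w|w []].
Qed.

Lemma prob_arrivals_sum_ge s n m (z M : R) : 1 <= z ->
  (\sum_(0 <= k <oo) (p k * z ^+ k)%:E = M%:E)%E ->
  (P [set w | (m <= \sum_(s <= i < s + n) X i w)%N] <= (z ^- m * M ^+ n)%:E)%E.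
Proof.
move=> z1 sumM.
have -> : [set w | (m <= \sum_(s <= i < s + n) X i w)%N] =
    [set w | (m <= sumn (arrivals s n w))%N].
  by apply/seteqP; split => w /=;
    rewrite /arrivals sumnE big_map /index_iota addKn.
rewrite (prob_arrivals s n (fun t => m <= sumn t)%N).
exact: (chernoff_iterated_series n m pmf_ge0).
Qed.

End Arrivals.

(** * Monotonicity, limit and bounds of the outage probability *)

Section OutageProbability.
Context {d : measure_display} {Omega : measurableType d} {R : realType}.
Variables (P : probability Omega R) (p : nat -> R).
Variable Q : nat -> {RV P >-> nat}.
Hypothesis pmf_Q : forall j k, distribution P (Q j.+1) [set k] = (p k)%:E.
Hypothesis indep_Q : mutually_independent (fun n => Q n.+1).
Variables C T : nat.

(** The system started [s] slots later, with its own clock: its slot [k] receives the arrivals of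
    slot [s + k]. *)
Let outage_from s n :=
  [set w : Omega | outage C T (fun k => Q (s + k)%N w) n.+1].

Let outage_seq n (u : seq nat) := outage C T (fun k => nth 0%N u k.-1) n.+1.

Let outage_fromE s n : outage_from s n =
  [set w | outage_seq n (arrivals (fun k => Q k.+1) s n.+1 w)].
Proof.
suff eqE w : outage C T (fun k => Q (s + k)%N w) n.+1 =
    outage_seq n (arrivals (fun k => Q k.+1) s n.+1 w).
  by apply/seteqP; split => w; rewrite /outage_from /= eqE.
apply: eq_outage => -[//|k] /andP[_ kn] /=.
rewrite /arrivals (nth_map 0%N) ?size_iota// nth_iota// addnS//.
Qed.

Let measurable_outage_from s n : measurable (outage_from s n).
Proof. by rewrite outage_fromE; exact: measurable_arrivals. Qed.

Lemma outage_prob_nondecreasing n :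
  (outage_prob C T Q n.+1 <= outage_prob C T Q n.+2)%E.
Proof.
(* By stationarity, starting one slot later does not change the probability. *)
have -> : outage_prob C T Q n.+1 = P (outage_from 1 n).
  rewrite (_ : outage_prob _ _ _ _ = P (outage_from 0 n))//.
  by rewrite !outage_fromE !(prob_arrivals pmf_Q indep_Q).
apply: le_measure; rewrite ?inE.
- exact: measurable_outage_from.
- exact: (measurable_outage_from 0 n.+1).
- by move=> w; exact: outage_delayed_start.
Qed.

Lemma is_cvg_outage_prob : cvgn (outage_prob C T Q).
Proof.
(* The term of index 0 would involve [Q 0], whose law is not prescribed, hence the shift. *)
have : cvgn [sequence outage_prob C T Q n.+1]_n.
  apply: ereal_nondecreasing_is_cvgn; apply/nondecreasing_seqP => n.
  exact: outage_prob_nondecreasing.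
move=> cv; apply: cvgP (limn [sequence outage_prob C T Q n.+1]_n) _.
by rewrite -cvg_shiftS.
Qed.

Lemma outage_prob_le_steady n :
  (outage_prob C T Q n.+1 <= steady_outage_prob C T Q)%E.
Proof.
apply: lime_ge; first exact: is_cvg_outage_prob.
exists n.+1 => // -[//|m] /= nm.
have nd : nondecreasing_seq [sequence outage_prob C T Q k.+1]_k.
  by apply/nondecreasing_seqP => k; exact: outage_prob_nondecreasing.
exact: nd.
Qed.

(** A single value of the mass function, the least burst in slot 1 that overloads [T.+1] slots,
    already has the right exponent. *)
Lemma steady_outage_prob_ge_pmf :
  ((p (T.+1 * C).+1)%:E <= steady_outage_prob C T Q)%E.
Proof.
apply: le_trans (outage_prob_le_steady T).
have <- : P (Q 1%N @^-1` [set (T.+1 * C).+1]) = (p (T.+1 * C).+1)%:E.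
  exact: (pmf_Q 0).
apply: le_measure; rewrite ?inE.
- exact: (measurable_funPTI (Q 1%N)).
- exact: (measurable_outage_from 0 T).
- move=> w /= q1; apply: outage_first_burst; by rewrite q1.
Qed.

Lemma steady_outage_prob_le (b : \bar R) :
  (forall n, outage_prob C T Q n.+1 <= b)%E ->
  (steady_outage_prob C T Q <= b)%E.
Proof.
move=> le_b; apply: lime_le; first exact: is_cvg_outage_prob.
by exists 1%N => // -[].
Qed.

Lemma steady_outage_prob_le1 : (steady_outage_prob C T Q <= 1)%E.
Proof.
apply: steady_outage_prob_le => n; apply: probability_le1.
exact: (measurable_outage_from 0 n).
Qed.

Lemma outage_prob_chernoff (z M : R) n : 1 <= z ->
  (\sum_(0 <= k <oo) (p k * z ^+ k)%:E = M%:E)%E ->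
  (outage_prob C T Q n.+1 <=
   (\sum_(i < n.+1) z ^- ((T + i.+1) * C) * M ^+ i.+1)%:E)%E.
Proof.
move=> z1 sumM; pose X k := Q k.+1.
(* [A i] is the overload by a busy period with [j = i.+1]. The upper end is written so that the
   window has length [i.+1] even when the subtraction truncates, so the Chernoff bound applies to
   every [i]. *)
pose A i := [set w | ((T + i.+1) * C <= \sum_(n.+1 - T - i.+1 <= k <
  n.+1 - T - i.+1 + i.+1) X k w)%N].
have AE i : A i = [set w | ((T + i.+1) * C <=
    sumn (arrivals X (n.+1 - T - i.+1) i.+1 w))%N].
  apply/seteqP; split => w;
    by rewrite /A /mkset /arrivals sumnE big_map /index_iota addKn.
have mA i : measurable (A i).
  rewrite AE; exact: (@measurable_arrivals _ _ _ P X _ _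
    (fun u => (T + i.+1) * C <= sumn u)%N).
apply: (@le_trans _ _ (\sum_(i < n.+1) P (A i))%E); last first.
  rewrite -sumEFin; apply: lee_sum => i _.
  exact: (@prob_arrivals_sum_ge _ _ _ P p X pmf_Q indep_Q).
apply: le_trans (Boole_inequality P (fun i _ => mA i)).
apply: le_measure; rewrite ?inE.
- exact: (measurable_outage_from 0 n).
- exact: bigsetU_measurable.
move=> w /outage_busy_period[j [+ + +]].
case: j => // j _ jn lt_sum; rewrite -bigcup_mkord.
exists j => /=; first by lia.
rewrite /A /= ltnW//; move: lt_sum.
rewrite big_add1/= (_ : (n.+1 - T - j.+1 + j.+1 = n.+1 - T)%N)//; lia.
Qed.

End OutageProbability.

(** * Real estimates for the Poisson mass and the Chernoff series *)

Lemma fact_leq_expn n : (n`! <= n ^ n)%N.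
Proof.
elim: n => // n IH; rewrite factS expnS leq_mul2l/=.
apply: leq_trans IH _; by case: n => // n; rewrite leq_exp2r.
Qed.

Section Estimates.
Context {R : realType}.
Implicit Types (gamma x : R) (C T : nat).

Lemma geometric_sum_le x n : 0 <= x -> 2 * x <= 1 ->
  \sum_(i < n) x ^+ i.+1 <= 2 * x.
Proof.
move=> x0 x1.
(* The subtracted term makes the induction pass, since [2 * x ^+ n.+2 <= x ^+ n.+1]. *)
suff : \sum_(i < n) x ^+ i.+1 <= 2 * x - 2 * x ^+ n.+1.
  by move/le_trans; apply; rewrite gerBl mulr_ge0// exprn_ge0.
elim: n => [|n IH]; first by rewrite big_ord0 expr1 subrr.
rewrite big_ord_recr/= (le_trans (lerD IH (lexx _)))//.
have := exprn_ge0 n.+1 x0; rewrite [x ^+ n.+2]exprS; nra.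
Qed.

Lemma poisson_pmf_gt0 (rate : R) k : 0 < rate -> 0 < poisson_pmf rate k.
Proof.
move=> r0; rewrite /poisson_pmf r0.
by rewrite !mulr_gt0 ?exprn_gt0 ?invr_gt0 ?expR_gt0 ?ltr0n ?fact_gt0.
Qed.

(** With [m = (T.+1 * C).+1], this combines [m! <= m ^ m], [m <= T.+2 * C] and the bound of the rate
    by [C]. *)
Lemma ln_poisson_pmf_ge gamma C T : (0 < C)%N -> 0 <= gamma <= 1 ->
  - ln (poisson_pmf (C%:R `^ gamma) (T.+1 * C).+1) <=
  C%:R + (T.+1 * C).+1%:R * ((1 - gamma) * ln C%:R + ln T.+2%:R).
Proof.
move=> C0 /andP[g0 g1]; set m := (T.+1 * C).+1.
have C1 : 1 <= C%:R :> R by rewrite ler1n.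
have CP : 0 < C%:R :> R by rewrite ltr0n.
have lP : 0 < C%:R `^ gamma by rewrite powR_gt0.
have fP : 0 < m`!%:R :> R by rewrite ltr0n fact_gt0.
have le_m : (m <= T.+2 * C)%N by rewrite /m mulSn -addn1 addnC leq_add2r.
have ln_fact : ln m`!%:R <= m%:R * (ln C%:R + ln T.+2%:R) :> R.
  rewrite addrC -lnM ?posrE ?ltr0n// -natrM.
  rewrite (@le_trans _ _ (ln (m ^ m)%:R))//.
    by rewrite ler_ln ?posrE ?ltr0n ?fact_gt0 ?expn_gt0// ler_nat fact_leq_expn.
  rewrite natrX lnXn ?ltr0n// -[leLHS]mulr_natl ler_wpM2l//.
  by rewrite ler_ln ?posrE ?ltr0n ?muln_gt0// ler_nat.
have l_le : C%:R `^ gamma <= C%:R.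
  by rewrite -[leRHS]powRr1 ?ler_powR// ltW.
rewrite /poisson_pmf lP !lnM ?posrE ?mulr_gt0 ?invr_gt0 ?exprn_gt0 ?expR_gt0//.
rewrite expRK lnV ?posrE// lnXn// ln_powR.
rewrite -[(gamma * _) *+ _]mulr_natl; lra.
Qed.

Lemma chernoff_sum_le gamma C T n (z := expR ((1 - gamma) * ln C%:R)) :
  (0 < C)%N -> gamma <= 1 ->
  2 <= (1 - gamma) * ln C%:R ->
  \sum_(i < n) z ^- ((T + i.+1) * C) *
    expR (C%:R `^ gamma * (z - 1)) ^+ i.+1 <=
  expR (2 * C%:R - T.+1%:R * (1 - gamma) * (C%:R * ln C%:R)).
Proof.
move=> C0 g1; pose gL := (1 - gamma) * ln C%:R => gL2.
have {gL2} gL2 : 2 <= gL by [].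
have C1 : 1 <= C%:R :> R by rewrite ler1n.
have CP : 0 < C%:R :> R by rewrite ltr0n.
set M := expR (_ * _).
have le_M : M <= expR C%:R.
  rewrite ler_expR mulrBr mulr1 /z /powR gt_eqF// -expRD -mulrDl.
  by rewrite (addrC gamma) subrK mul1r lnK ?posrE// gerBl expR_ge0.
(* As [lambda * z = C], [M <= expR C] and [x] bounds the ratio of the series. *)
pose x := expR (C%:R - C%:R * gL).
(* As [gL] is at least 2, [x] is at most [expR (- C)], and [C] is at least 1. *)
have x_small : 2 * x <= 1.
  have e2 : 2 <= expR 1 :> R by have := @expR_ge1Dx R 1; lra.
  apply: (@le_trans _ _ (expR 1 * x)).
    by rewrite ler_wpM2r// expR_ge0.
  by rewrite /x -expRD -[leRHS]expR0 ler_expR; nra.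
have term i : z ^- ((T + i.+1) * C) * M ^+ i.+1 <=
    expR (- (T%:R * C%:R * gL)) * x ^+ i.+1.
  apply: (@le_trans _ _ (z ^- ((T + i.+1) * C) * expR C%:R ^+ i.+1)).
    rewrite ler_wpM2l ?invr_ge0 ?exprn_ge0 ?expR_ge0//.
    by rewrite lerXn2r ?nnegrE ?expR_ge0.
  rewrite /z /x -!expRM_natl -expRN -!expRD ler_expR natrM natrD -/gL; lra.
apply: le_trans; first by apply: ler_sum => i _; exact: term.
rewrite -mulr_sumr.
apply: (@le_trans _ _ (expR (- (T%:R * C%:R * gL)) * (2 * x))).
  by rewrite ler_wpM2l ?expR_ge0 ?geometric_sum_le ?expR_ge0.
have e2 : 2 <= expR 1 :> R by have := @expR_ge1Dx R 1; lra.
(* The factor 2 is absorbed into [expR 1]; then [1 + C <= 2 * C] gives the constant of the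
   statement. *)
apply: (@le_trans _ _ (expR (- (T%:R * C%:R * gL)) * (expR 1 * x))).
  by rewrite ler_wpM2l ?expR_ge0// ler_wpM2r ?expR_ge0.
rewrite /x -!expRD ler_expR /gL -natr1; nra.
Qed.

Lemma cvg_ln_natr : (ln C%:R : R) @[C --> \oo] --> +oo.
Proof.
apply/cvgryPge => A; near=> C.
rewrite -ler_expR lnK ?posrE; last by near: C; exact: nbhs_infty_gtr.
by near: C; exact: nbhs_infty_ger.
Unshelve. all: by end_near. Qed.

(** Common shape of both bounds on the diversity ratio: an error of order [C] in the exponent
    becomes [c / ln C] after division by [C * ln C]. *)
Lemma cvg_addr_div_ln (a c : R) :
  (a + c / ln C%:R)%:E @[C --> \oo] --> a%:E.
Proof.
apply: cvg_EFin; first by near=> C.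
rewrite -[X in _ --> X]addr0 -[X in _ --> _ + X](mulr0 c).
apply: cvgD; first exact: cvg_cst.
apply: cvgM; first exact: cvg_cst.
apply/gtr0_cvgV0; last exact: cvg_ln_natr.
by near=> C; rewrite ln_gt0// ltr1n; near: C; exact: nbhs_infty_gt.
Unshelve. all: by end_near. Qed.

End Estimates.

(** * Squeezing the diversity ratio *)

Section DiversityRatio.
Context {R : realType} {d : nat -> measure_display}
  {Omega : forall C, measurableType (d C)}.
Variables (P : forall C, probability (Omega C) R).
Variable Q : forall C, nat -> {RV (P C) >-> nat}.
Variables (gamma : R) (T : nat).
Hypothesis gamma01 : 0 <= gamma <= 1.
Hypothesis poisson_Q : forall C, (0 < C)%N ->
  iid_poisson (C%:R `^ gamma) (fun n => Q C n.+1).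

(** Finiteness and positivity let the extended logarithm be computed in [R]. *)
Lemma steady_outage_probE C : (0 < C)%N -> exists s : R,
  [/\ steady_outage_prob C T (Q C) = s%:E, 0 < s, s <= 1 &
    poisson_pmf (C%:R `^ gamma) (T.+1 * C).+1 <= s].
Proof.
move=> C0; have [pmf indep] := poisson_Q C0.
have lP : 0 < C%:R `^ gamma by rewrite powR_gt0 ?ltr0n.
have := steady_outage_prob_le1 pmf indep C T.
have := steady_outage_prob_ge_pmf pmf indep C T.
case: (steady_outage_prob C T (Q C)) => [s| |]//.
rewrite !lee_fin => ps s1; exists s; split=> //.
exact: lt_le_trans (poisson_pmf_gt0 _ lP) ps.
Qed.

Lemma diversity_ratio_le C : (1 < C)%N ->
  (diversity_ratio Q T C <=
   (T.+1%:R * (1 - gamma) + (2 + T.+2%:R * ln T.+2%:R) / ln C%:R)%:E)%E.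
Proof.
move=> C1; have C0 := ltnW C1.
have L0 : 0 < ln C%:R :> R by rewrite ln_gt0// ltr1n.
have CP : 1 <= C%:R :> R by rewrite ler1n.
have CL0 : 0 < C%:R * ln C%:R :> R by rewrite mulr_gt0// ltr0n.
have K0 : 0 <= ln T.+2%:R :> R by rewrite ln_ge0// ler1n.
have LC : ln C%:R <= C%:R :> R by rewrite ltW// ln_sublinear// ltr0n.
have [s [sE s0 _ le_s]] := steady_outage_probE C0.
have := ln_poisson_pmf_ge T C0 gamma01.
rewrite /diversity_ratio sE lne_EFin// inver gt_eqF// -EFinM lee_fin.
have pmf0 : 0 < poisson_pmf (C%:R `^ gamma) (T.+1 * C).+1.
  by rewrite poisson_pmf_gt0// powR_gt0// ltr0n.
have : ln (poisson_pmf (C%:R `^ gamma) (T.+1 * C).+1) <= ln s.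
  by rewrite ler_ln ?posrE.
rewrite ler_pdivrMr//.
(* The constant 2 collects the rate and [(1 - gamma) * ln C], each at most [C]; the other term comes
   from [(T.+1 * C).+1 <= T.+2 * C]. *)
rewrite [X in _ -> _ -> _ <= X](_ : _ = T.+1%:R * (1 - gamma) *
    (C%:R * ln C%:R) + (2 + T.+2%:R * ln T.+2%:R) * C%:R); last first.
  by field; rewrite gt_eqF.
move: gamma01 => /andP[g0 g1].
move: (ln T.+2%:R) (ln s) (ln (poisson_pmf _ _)) K0 => K ls lp K0.
rewrite -[(T.+1 * C).+1%:R]natr1 natrM -[T.+2%:R]natr1 => h1 h2.
have gL : (1 - gamma) * ln C%:R <= C%:R by nra.
have KC : K <= K * C%:R by nra.
lra.
Qed.

(** The alternative holds for all large [C]: either [gamma] is 1, or [(1 - gamma) * ln C] tends to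
    infinity and the Chernoff series converges geometrically. *)
Lemma diversity_ratio_ge C : (1 < C)%N ->
  (1 - gamma = 0 \/ 2 <= (1 - gamma) * ln C%:R) ->
  ((T.+1%:R * (1 - gamma) + - 2 / ln C%:R)%:E <= diversity_ratio Q T C)%E.
Proof.
move=> C1; have C0 := ltnW C1.
have L0 : 0 < ln C%:R :> R by rewrite ln_gt0// ltr1n.
have CP : 1 <= C%:R :> R by rewrite ler1n.
have CL0 : 0 < C%:R * ln C%:R :> R by rewrite mulr_gt0// ltr0n.
have [s [sE s0 s1 _]] := steady_outage_probE C0.
rewrite /diversity_ratio sE lne_EFin// inver gt_eqF// -EFinM lee_fin.
have ls0 : ln s <= 0 by rewrite ln_le0.
move=> [->|gL2].
  rewrite mulr0 add0r (@le_trans _ _ 0)//.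
    by rewrite mulNr oppr_le0 divr_ge0// ltW.
  by rewrite divr_ge0// ?oppr_ge0// ltW.
rewrite ler_pdivlMr//.
rewrite [leLHS](_ : _ = - (2 * C%:R - T.+1%:R * (1 - gamma) *
    (C%:R * ln C%:R))); last by field; rewrite gt_eqF.
rewrite lerN2 -ler_expR lnK ?posrE//.
rewrite -lee_fin -sE; have [pmf indep] := poisson_Q C0.
apply: (steady_outage_prob_le pmf indep) => n.
have lP : 0 < C%:R `^ gamma by rewrite powR_gt0 ?ltr0n.
move: gamma01 => /andP[_ g1].
have z1 : 1 <= expR ((1 - gamma) * ln C%:R).
  by rewrite -[leLHS]expR0 ler_expR; lra.
apply: le_trans (outage_prob_chernoff pmf indep C T n z1
  (poisson_mgf lP (expR_gt0 _))) _.
by rewrite lee_fin chernoff_sum_le.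
Qed.

Lemma cvg_diversity_ratio :
  diversity_ratio Q T C @[C --> \oo] --> ((1 + T%:R) * (1 - gamma))%:E.
Proof.
rewrite nat1r.
apply: (squeeze_cvge _ (@cvg_addr_div_ln R _ (- 2))
  (@cvg_addr_div_ln R _ (2 + T.+2%:R * ln T.+2%:R))).
have large : \forall C \near \oo,
    1 - gamma = 0 \/ 2 <= (1 - gamma) * ln C%:R :> R.
  move: gamma01 => /andP[_]; rewrite -subr_ge0 le_eqVlt => /predU1P[<-|g0].
    by near=> C; left.
  near=> C; right; rewrite mulrC -ler_pdivrMr//; near: C.
  by move/cvgryPge: (@cvg_ln_natr R); exact.
near=> C; have C1 : (1 < C)%N by near: C; exact: nbhs_infty_gt.
rewrite diversity_ratio_le// andbT diversity_ratio_ge//.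
by near: C; exact: large.
Unshelve. all: by end_near. Qed.

End DiversityRatio.

Unset Implicit Arguments.

Theorem theorem1 (R : realType) (gamma : R) (T : nat)
    (d : nat -> measure_display) (Omega : forall C : nat, measurableType (d C))
    (P : forall C : nat, probability (Omega C) R)
    (Q : forall C : nat, nat -> {RV (P C) >-> nat}) :
  0 <= gamma <= 1 ->
  (forall C : nat, (0 < C)%N ->
     iid_poisson (C%:R `^ gamma) (fun n : nat => Q C n.+1)) ->
  [/\ forall C : nat, (0 < C)%N ->
        cvgn (outage_prob C T (Q C)) /\ cvgn (outage_prob C 0 (Q C)),
      diversity_ratio Q T C @[C --> \oo] --> ((1 + T%:R) * (1 - gamma))%:E,
      diversity_ratio Q 0 C @[C --> \oo] --> (1 - gamma)%:E
    & diversity_gain Q T = ((1 + T%:R)%:E * diversity_gain Q 0)%E].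
Proof.
move=> gamma01 poisson_Q.
have cvg_ratio S :=
  @cvg_diversity_ratio R d Omega P Q gamma S gamma01 poisson_Q.
split.
- move=> C C0; have [pmf indep] := poisson_Q C C0.
  by split; exact: is_cvg_outage_prob pmf indep C _.
- exact: cvg_ratio.
- by have := cvg_ratio 0%N; rewrite addr0 mul1r.
- rewrite /diversity_gain (cvg_lim _ (cvg_ratio T))//.
  by rewrite (cvg_lim _ (cvg_ratio 0%N))// addr0 mul1r EFinM.
Qed.
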